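(* Let $n,p\ge 1$ be integers and let $n_1,n_2,r_1,r_2\ge 0$ be integers with $n_1+n_2=n$ and $r_1+r_2=p$. Let $$\alpha_1\ge\alpha_2\ge\dots\ge\alpha_n,\qquad \beta_1\ge\beta_2\ge\dots\ge\beta_p$$ be real numbers in $(0,1)$ with $\alpha_1=\beta_1$. For $\gamma\in(0,1)$ let $\theta_\gamma=1-\left(\frac{1-\gamma}{2}\right)^{k_\gamma}$, with the positive integer $k_\gamma$ defined in the context, and let $$\chi=\prod_{i=1}^{n}\theta_{\alpha_i}\prod_{i=1}^{p}\theta_{\beta_i}.$$ Suppose that $$\chi\sum_{i=1}^{n_1}\Big(\frac{1-\alpha_i}{2}\Big)^2>\frac{3\alpha_1-1}{1+\alpha_1},\qquad \chi\sum_{i=1+n_1}^{n_1+n_2}\Big(\frac{1-\alpha_i}{2}\Big)>1,$$ and $$\chi\sum_{i=1}^{r_1}\Big(\frac{1-\beta_i}{2}\Big)^2>\frac{3\beta_1-1}{1+\beta_1},\qquad \chi\sum_{i=1+r_1}^{r_1+r_2}\Big(\frac{1-\beta_i}{2}\Big)>1.$$ Then both of the intervals $$\left[\left(\prod_{i=1}^{p}\Big(1-\Big(\frac{1-\beta_i}{2}\Big)^{k_{\beta_i}}\Big)\right)\Big(1-\Big(\frac{1-\alpha_1}{2}\Big)^{k_{\alpha_1}}\Big),\ \prod_{i=2}^{p}\Big(1-\Big(\frac{1-\beta_i}{2}\Big)^{k_{\beta_i}}\Big)\right],$$ $$\left[\left(\prod_{i=1}^{n}\Big(1-\Big(\frac{1-\alpha_i}{2}\Big)^{k_{\alpha_i}}\Big)\right)\Big(1-\Big(\frac{1-\beta_1}{2}\Big)^{k_{\beta_1}}\Big),\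 \prod_{i=2}^{n}\Big(1-\Big(\frac{1-\alpha_i}{2}\Big)^{k_{\alpha_i}}\Big)\right]$$ are contained in the set $$\Gamma=\left\{\prod_{k=1}^{n}c_k\prod_{l=1}^{p}d_l : c_k\in C_{\alpha_k},\ d_l\in C_{\beta_l}\right\},$$ where $C_\gamma$ denotes the central Cantor set with parameter $\gamma$.
   Context: Central Cantor set. For $\alpha\in(0,1)$, $C_\alpha=\bigcap_{l\ge 1}C_l$, where $C_0=[0,1]$ and, for $l\ge 1$, $C_l$ is obtained from $C_{l-1}$ (a disjoint union of $2^{l-1}$ closed intervals of equal length) by removing from each of these closed intervals the open interval with the same centre and with length $\alpha$ times the length of that closed interval. The integer $k_\gamma$ for $\gamma\in(0,1)$. If $\gamma\le 1/3$: let $a_0>1$ be the real number such that the graph of $t\mapsto a_0^{2t-1}$ is tangent to the line $y=t-1$, and set $$k_\gamma=\left\lceil\frac{\log(1-\frac{1}{a_0})}{\log(\frac{1-\gamma}{2})}\right\rceil.$$ If $\gamma>1/3$: set $b_\gamma=\frac{1-\gamma^2}{6\gamma-1-\gamma^2}$, let $a_1>1$ (depending on $\gamma$) be the real number such that the graph of $t\mapsto a_1^{2t-1}$ is tangent to the line $y=b_\gamma(t-3)$ (equivalently $a_1^5\log a_1=\frac{b_\gamma}{2e}$), and set $$k_\gamma=\left\lceil\frac{\log(1-\frac{1}{a_1})}{\log(\frac{1-\gamma}{2})}\right\rceil.$$ Empty sums are $0$ and empty products are $1$. *)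

(* Defs.v *)
From HB Require Import structures.
From mathcomp Require Import all_boot all_order all_algebra.
From mathcomp Require Import all_classical all_reals all_analysis.
Set Implicit Arguments.
Unset Strict Implicit.
Unset Printing Implicit Defensive.
Import Order.TTheory GRing.Theory Num.Theory.
Import numFieldNormedType.Exports.
Local Open Scope classical_set_scope.
Local Open Scope ring_scope.

(* The two closed intervals left of [x, y] when the open interval with the
   same centre and with length alpha * (y - x) is removed; a closed interval is
   represented by the pair of its end points. *)
Definition remove_middle (R : realType) (alpha : R) (J : R * R) : seq (R * R) :=
  let centre := (J.1 + J.2) / 2 in
  let halfgap := alpha * (J.2 - J.1) / 2 in
  [:: (J.1, centre - halfgap); (centre + halfgap, J.2)].

Fixpoint cantor_intervals (R : realType) (alpha : R) (l : nat) : seq (R * R) :=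
  if l is l'.+1 then
    flatten [seq remove_middle alpha J | J <- cantor_intervals alpha l']
  else [:: (0, 1)].

Definition cantor_stage (R : realType) (alpha : R) (l : nat) : set R :=
  [set x | exists2 J, J \in cantor_intervals alpha l & J.1 <= x <= J.2].

Definition central_cantor (R : realType) (alpha : R) : set R :=
  \bigcap_(l in [set l | (1 <= l)%N]) cantor_stage alpha l.

(* The graph of f is tangent to the line y = m (t - c). *)
Definition tangent_line (R : realType) (f : R -> R) (m c : R) : Prop :=
  exists t : R, f t = m * (t - c) /\ is_derive t 1 f m.

Definition tangent_base (R : realType) (m c : R) : set R :=
  [set a | 1 < a /\ tangent_line (fun t => a `^ (2 * t - 1)) m c].

Definition b_gamma (R : realType) (gamma : R) : R :=
  (1 - gamma ^+ 2) / (6 * gamma - 1 - gamma ^+ 2).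

(* For m > 0 the set tangent_base m c is a singleton for c = 1 and for c = 3
   (tangency amounts to a `^ (2 * c - 1) * ln a = m / (2 * expR 1)), so that get
   returns its element. *)
Definition a_gamma (R : realType) (gamma : R) : R :=
  if gamma <= 1 / 3 then get (tangent_base 1 1)
  else get (tangent_base (b_gamma gamma) 3).

Definition k_gamma (R : realType) (gamma : R) : int :=
  Num.ceil (ln (1 - 1 / a_gamma gamma) / ln ((1 - gamma) / 2)).

Definition theta (R : realType) (gamma : R) : R :=
  1 - ((1 - gamma) / 2) ^ k_gamma gamma.

Definition chi (R : realType) (n p : nat) (alpha beta : nat -> R) : R :=
  (\prod_(1 <= i < n.+1) theta (alpha i)) * \prod_(1 <= i < p.+1) theta (beta i).

Definition Gamma (R : realType) (n p : nat) (alpha beta : nat -> R) : set R :=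
  [set x | exists c d : nat -> R,
    [/\ forall k, (1 <= k <= n)%N -> central_cantor (alpha k) (c k),
        forall l, (1 <= l <= p)%N -> central_cantor (beta l) (d l)
      & x = (\prod_(1 <= k < n.+1) c k) * \prod_(1 <= l < p.+1) d l]].

(* Main.v *)
Require Import Defs.
From HB Require Import structures.
From mathcomp Require Import all_boot all_order all_algebra.
From mathcomp Require Import all_classical all_reals all_analysis.
From mathcomp Require Import ring lra.
Set Implicit Arguments.
Unset Strict Implicit.
Unset Printing Implicit Defensive.
Import Order.TTheory GRing.Theory Num.Theory.
Import numFieldNormedType.Exports.
Local Open Scope classical_set_scope.
Local Open Scope ring_scope.

(** Write [r = (1 - gamma) / 2] for the contraction ratio of the Cantor set with
    parameter [gamma]. The main idea is a covering argument for products of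
    several cylinders (intervals of the construction). Let the cylinders
    [[a i, a i + s i]] lie in [[theta, 1]], with lengths comparable in the sense
    that [r j * s i <= s j] for all [i] and [j], and suppose that
    [theta * \sum_i r i >= 1]. Split a longest cylinder [m] into its two
    children. The ratio of the end points of its gap is at most
    [1 + (1 - 2 * r m) * s m / theta], while the product of the other factors
    varies by a ratio of at least
    [1 + \sum_(i != m) s i >= 1 + (\sum_(i != m) r i) * s m], so that the two
    product intervals obtained overlap ([split_overlap]). Any [x] between
    [\prod_i a i] and [\prod_i (a i + s i)] therefore stays covered by one of
    the two families, whose lengths are again comparable. Each split decreases
    the total length by a fixed factor ([good_step]), so the nested cylinders
    shrink to points of the Cantor sets with product [x] ([good_mem_product]).

    For the first interval, apply this to the Cantor sets with parameters
    [alpha 1], ..., [alpha n] and [beta 1]. With [s = 1 - theta (alpha 1)], the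
    length of a rightmost cylinder for [alpha 1], choose in each of the other
    Cantor sets a rightmost cylinder of length between [r i * s] and [s]. All
    left end points are then at least [theta (alpha 1)], which is at least
    [chi], so that the bound on [chi] times the sum of the ratios gives the
    covering condition. Since [alpha 1 = beta 1], the cylinder for [beta 1] can
    be given the length [s] as well; the least product is then at most
    [theta (alpha 1) ^+ 2], and the products fill the whole interval from there
    to 1 ([product_covers_top]). Multiplying by the points [theta (beta i)] of
    the remaining Cantor sets, for [i] from 2 to [p], gives the first interval;
    the second one follows by exchanging the two families.

    Of the exponents only the positivity matters: it makes every [theta gamma] a
    point of the Cantor set in the open interval from 0 to 1. It follows from
    [1 < a_gamma gamma], that is, from the existence of the tangent curve
    ([tangent_base_nonempty]). *)

(** * Cylinders of a central Cantor set *)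

(** The contraction ratio of the two similarities that generate the central
    Cantor set with parameter [alpha]. *)
Definition cantor_ratio (R : realType) (alpha : R) : R := (1 - alpha) / 2.

(** The length of an interval given by the pair of its end points. *)
Definition width (R : realType) (J : R * R) : R := J.2 - J.1.

(** A cylinder is an interval of some stage of the construction. *)
Definition cylinder (R : realType) (alpha : R) (J : R * R) : Prop :=
  exists l, J \in cantor_intervals alpha l.

Definition left_child (R : realType) (alpha : R) (J : R * R) : R * R :=
  (J.1, J.1 + cantor_ratio alpha * width J).

Definition right_child (R : realType) (alpha : R) (J : R * R) : R * R :=
  (J.2 - cantor_ratio alpha * width J, J.2).

Lemma cantor_ratio_bounds (R : realType) (alpha : R) : 0 < alpha < 1 ->
  0 < cantor_ratio alpha < 1 / 2.
Proof. by rewrite /cantor_ratio => h; lra. Qed.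

Lemma remove_middleE (R : realType) (alpha : R) (J : R * R) :
  remove_middle alpha J = [:: left_child alpha J; right_child alpha J].
Proof.
by rewrite /remove_middle /left_child /right_child /cantor_ratio /width /=;
  do 2?[congr (_ :: _)]; congr pair; field.
Qed.

Lemma mem_cantor_intervalsS (R : realType) (alpha : R) (l : nat) (J : R * R) :
  J \in cantor_intervals alpha l.+1 <->
  exists2 J0, J0 \in cantor_intervals alpha l &
    J = left_child alpha J0 \/ J = right_child alpha J0.
Proof.
split=> [/flatten_mapP[J0 J0l]|[J0 J0l h]].
  by rewrite remove_middleE !inE => /orP[] /eqP ->; exists J0; auto.
apply/flatten_mapP; exists J0 => //; rewrite remove_middleE !inE.
by case: h => ->; rewrite eqxx ?orbT.
Qed.

Lemma cylinder_left_child (R : realType) (alpha : R) (J : R * R) :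
  cylinder alpha J -> cylinder alpha (left_child alpha J).
Proof.
by move=> [l Jl]; exists l.+1; apply/mem_cantor_intervalsS; exists J; auto.
Qed.

Lemma cylinder_right_child (R : realType) (alpha : R) (J : R * R) :
  cylinder alpha J -> cylinder alpha (right_child alpha J).
Proof.
by move=> [l Jl]; exists l.+1; apply/mem_cantor_intervalsS; exists J; auto.
Qed.

Lemma width_left_child (R : realType) (alpha : R) (J : R * R) :
  width (left_child alpha J) = cantor_ratio alpha * width J.
Proof. by rewrite /left_child /width /=; ring. Qed.

Lemma width_right_child (R : realType) (alpha : R) (J : R * R) :
  width (right_child alpha J) = cantor_ratio alpha * width J.
Proof. by rewrite /right_child /width /=; ring. Qed.

Lemma cylinder_width_ge0 (R : realType) (alpha : R) (J : R * R) :
  0 < alpha < 1 -> cylinder alpha J -> 0 <= width J.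
Proof.
move=> /cantor_ratio_bounds r01 [l]; elim: l J => [|l IHl] J /=.
  by rewrite inE => /eqP ->; rewrite /width /= subr0.
move=> /mem_cantor_intervalsS[J0 /IHl w0].
case=> ->; rewrite ?width_left_child ?width_right_child; nra.
Qed.

(** A cylinder meets every stage at its left end point: the later stages keep
    the left end points, and the earlier ones contain the cylinder. *)
Lemma cylinder_left_end (R : realType) (alpha : R) (J : R * R) :
  0 < alpha < 1 -> cylinder alpha J -> central_cantor alpha J.1.
Proof.
move=> a01 [l Jl] m _.
have [m_le_l|/ltnW l_le_m] := leqP m l.
  (* The induction carries the inclusion of the whole interval. *)
  suff [J0 J0m [h1 h2]] : exists2 J0, J0 \in cantor_intervals alpha m &
      J0.1 <= J.1 /\ J.2 <= J0.2.
    exists J0 => //; rewrite h1 /= (le_trans _ h2) //.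
    by rewrite -subr_ge0; apply: (@cylinder_width_ge0 _ alpha) => //; exists l.
  elim: l J Jl m_le_l => [|l IHl] J Jl.
    by rewrite leqn0 => /eqP ->; exists J.
  rewrite leq_eqVlt => /predU1P[->|]; first by exists J.
  rewrite ltnS => /IHl {}IHl.
  have /mem_cantor_intervalsS[J0 J0l hJ] := Jl.
  have [K Km [h1 h2]] := IHl _ J0l.
  have w0 : 0 <= width J0.
    by apply: (@cylinder_width_ge0 _ alpha) => //; exists l.
  have r01 := cantor_ratio_bounds a01.
  exists K => //; case: hJ => ->; rewrite /= /width in w0 *; split; nra.
have [K Km ->] : exists2 K, K \in cantor_intervals alpha m & J.1 = K.1.
  rewrite -(subnK l_le_m); elim: (m - l)%N => [|k [K Kk ->]]; first by exists J.
  exists (left_child alpha K) => //.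
  by apply/mem_cantor_intervalsS; exists K; auto.
exists K => //; rewrite lexx /= -subr_ge0.
by apply: (@cylinder_width_ge0 _ alpha) => //; exists m.
Qed.

Lemma closed_central_cantor (R : realType) (alpha : R) :
  closed (central_cantor alpha).
Proof.
apply: closed_bigI => l _.
rewrite /cantor_stage; elim: (cantor_intervals alpha l) => [|J s IHs].
  rewrite (_ : [set _ | _] = set0); first exact: closed0.
  by rewrite -subset0 => x [].
rewrite (_ : [set _ | _] =
    `[J.1, J.2] `|` [set x | exists2 K, K \in s & K.1 <= x <= K.2]).
  by apply: closedU => //; exact: interval_closed.
rewrite eqEsubset; split=> x /=.
  move=> [K]; rewrite inE => /predU1P[-> h|Ks h]; last by right; exists K.
  by left; rewrite in_itv.
rewrite in_itv /= => -[h|[K Ks h]]; first by exists J => //; rewrite inE eqxx.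
by exists K => //; rewrite inE Ks orbT.
Qed.

(** The rightmost cylinder of level [l]. *)
Lemma cylinder_top (R : realType) (alpha : R) (l : nat) :
  cylinder alpha (1 - cantor_ratio alpha ^+ l, 1).
Proof.
exists l; elim: l => [|l IHl]; first by rewrite expr0 subrr inE.
apply/mem_cantor_intervalsS; exists (1 - cantor_ratio alpha ^+ l, 1) => //.
by right; rewrite /right_child /width /= exprS; congr pair; ring.
Qed.

(** * Covering by products of cylinders *)

(** [good gamma theta x J] is the invariant of the subdivision: the [J i] are
    nondegenerate cylinders in [[theta, 1]] of comparable lengths, and [x] lies
    between the least and the greatest product of their points. The comparison
    of lengths is preserved when a longest interval is replaced by a child. *)
Definition good (R : realType) (I : finType) (gamma : I -> R) (theta x : R)
    (J : I -> R * R) : Prop :=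
  [/\ forall i, cylinder (gamma i) (J i) /\ 0 < width (J i),
      forall i, theta <= (J i).1 /\ (J i).2 <= 1,
      forall i j, cantor_ratio (gamma j) * width (J i) <= width (J j)
    & \prod_i (J i).1 <= x <= \prod_i (J i).2].

Lemma prod_right_ends_ge (R : realType) (I : finType) (P : pred I)
    (J : I -> R * R) :
  (forall i, 0 <= (J i).1 <= 1) -> (forall i, 0 <= width (J i)) ->
  (\prod_(i | P i) (J i).1) * (1 + \sum_(i | P i) width (J i)) <=
    \prod_(i | P i) (J i).2.
Proof.
move=> J01 w0.
suff [] : 0 <= \prod_(i | P i) (J i).1 /\ (0 <= \sum_(i | P i) width (J i) /\
    (\prod_(i | P i) (J i).1) * (1 + \sum_(i | P i) width (J i)) <=
    \prod_(i | P i) (J i).2) by move=> _ [].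
pose K a s b : Prop := 0 <= a :> R /\ 0 <= s :> R /\ a * (1 + s) <= b :> R.
apply: (big_rec3 K); first by rewrite /K; lra.
move=> i a s b _ [a0 [s0 h]].
have := J01 i; have := w0 i; rewrite /K /width.
move: (J i) => [u v] /= uv u01.
split; first by nra.
split; first by nra.
apply: (@le_trans _ _ (v * (a * (1 + s)))); last by apply: ler_wpM2l => //; lra.
rewrite -subr_ge0.
have -> : v * (a * (1 + s)) - u * a * (1 + (v - u + s)) =
  a * (v - u) * (1 - u) + a * s * (v - u) by ring.
by apply: addr_ge0; do ?apply: mulr_ge0 => //; lra.
Qed.

(** For every member [J m] of a good family, the products that use its left
    child overlap those that use its right child. *)
Lemma split_overlap (R : realType) (I : finType) (gamma : I -> R)
    (theta x : R) (J : I -> R * R) (m : I) :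
  (forall i, 0 < gamma i < 1) -> 0 < theta <= 1 ->
  1 <= theta * \sum_i cantor_ratio (gamma i) ->
  good gamma theta x J ->
  (right_child (gamma m) (J m)).1 * \prod_(i | i != m) (J i).1 <=
  (left_child (gamma m) (J m)).2 * \prod_(i | i != m) (J i).2.
Proof.
move=> g01 th01 hsum [Jcyl J01 Jcmp _].
have Jge0 i : 0 <= (J i).1 <= 1.
  by have [_] := Jcyl i; have [] := J01 i; rewrite /width; lra.
have w0 i : 0 <= width (J i) by have [_ /ltW] := Jcyl i.
have hprod := prod_right_ends_ge (fun i => i != m) Jge0 w0.
have P0 : 0 <= \prod_(i | i != m) (J i).1.
  by apply: prodr_ge0 => i _; have /andP[] := Jge0 i.
have hS : (\sum_(i | i != m) cantor_ratio (gamma i)) * width (J m) <=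
    \sum_(i | i != m) width (J i).
  by rewrite mulr_suml; apply: ler_sum => i _.
move: hsum; rewrite (bigD1 m) //=.
move: (\sum_(i | i != m) _) hS => T hS hsum.
have /cantor_ratio_bounds r01 := g01 m.
have [h1 h2] := J01 m; have [_ wm] := Jcyl m.
move: (\sum_(i | i != m) _) hS hprod => S hS hprod.
move: (\prod_(i | i != m) (J i).1) P0 hprod => P P0 hprod.
move: (\prod_(i | i != m) (J i).2) hprod => Q hQ.
rewrite /=; move: wm h1 h2 hS; rewrite /width; move: (J m) => [u v] /=.
move: (cantor_ratio _) r01 hsum => r r01 hsum wm h1 h2 hS.
have w1 : 0 < v - u by [].
apply: (@le_trans _ _ ((u + r * (v - u)) * (P * (1 + S)))); last first.
  by apply: ler_wpM2l => //; nra.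
have -> : (u + r * (v - u)) * (P * (1 + S)) = ((u + r * (v - u)) * (1 + S)) * P.
  by ring.
apply: ler_wpM2r => //.
have hT : 1 - r <= theta * T by nra.
have : (1 - r) * (v - u) <= theta * S.
  apply: (@le_trans _ _ (theta * (T * (v - u)))); last first.
    by apply: ler_wpM2l => //; lra.
  by rewrite mulrA ler_wpM2r //; lra.
have S0 : 0 <= S by nra.
have : theta * S <= u * S by apply: ler_wpM2r.
have : 0 <= r * (v - u) * S by do ?apply: mulr_ge0 => //; lra.
nra.
Qed.

Lemma good_step (R : realType) (I : finType) (gamma : I -> R)
    (theta x : R) (J : I -> R * R) :
  (forall i, 0 < gamma i < 1) -> 0 < theta <= 1 ->
  1 <= theta * \sum_i cantor_ratio (gamma i) ->
  good gamma theta x J ->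
  exists J', [/\ good gamma theta x J',
    forall i, (J i).1 <= (J' i).1 /\ (J' i).2 <= (J i).2 &
    \sum_i width (J' i) <= (1 - (2 * #|I|%:R)^-1) * \sum_i width (J i)].
Proof.
move=> g01 th01 hsum Jgood.
have [Jcyl J01 Jcmp /andP[xl xr]] := Jgood.
have [i0 _] : exists i0 : I, True.
  case: (pickP (mem I)) => [i0 _|I0]; first by exists i0.
  by move: hsum; rewrite big_pred0 ?mulr0 ?ler10 // => i; have := I0 i.
have [m wm] : exists m, forall i, width (J i) <= width (J m).
  have [m _ wm] := @arg_maxP _ _ _ i0 xpredT (fun i => width (J i)) isT.
  by exists m => i; apply: wm.
have overlap := split_overlap m g01 th01 hsum Jgood.
have r01 i := cantor_ratio_bounds (g01 i).
have [[cm wm0] [am bm]] := (Jcyl m, J01 m).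
(* Any replacement of [J m] by a child that keeps [x] covered will do. *)
suff main K : cylinder (gamma m) K ->
    width K = cantor_ratio (gamma m) * width (J m) ->
    (J m).1 <= K.1 -> K.2 <= (J m).2 ->
    K.1 * \prod_(i | i != m) (J i).1 <= x ->
    x <= K.2 * \prod_(i | i != m) (J i).2 ->
    exists J', [/\ good gamma theta x J',
      forall i, (J i).1 <= (J' i).1 /\ (J' i).2 <= (J i).2 &
      \sum_i width (J' i) <= (1 - (2 * #|I|%:R)^-1) * \sum_i width (J i)].
  have rm := r01 m.
  have [xL|/ltW xR] :=
    leP x ((left_child (gamma m) (J m)).2 * \prod_(i | i != m) (J i).2).
    apply: (main (left_child (gamma m) (J m))) => //.
    - exact: cylinder_left_child.
    - exact: width_left_child.
    - by move: wm0; rewrite /= /width; nra.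
    - by move: xl; rewrite (bigD1 m).
  apply: (main (right_child (gamma m) (J m))) => //.
  - exact: cylinder_right_child.
  - exact: width_right_child.
  - by move: wm0; rewrite /= /width; nra.
  - exact: le_trans overlap xR.
  - by move: xr; rewrite (bigD1 m).
move=> Kcyl wK K1 K2 xK1 xK2.
have rm := r01 m.
exists (fun i => if i == m then K else J i); split.
- split.
  + move=> i; case: eqP => [->|_]; last exact: Jcyl.
    by split=> //; rewrite wK; apply: mulr_gt0 => //; lra.
  + by move=> i; case: eqP => [_|_]; [lra|exact: J01].
  + move=> i j; have rj := r01 j; have wj := wm j.
    case: eqP => _; case: eqP => [->|_] //; rewrite ?wK.
    * by apply: ler_wpM2l; nra.
    * by apply: le_trans (Jcmp m j); apply: ler_wpM2l; nra.
    * by apply: ler_wpM2l; [lra|exact: wm].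
  + apply/andP; split; rewrite (bigD1 m) //= eqxx.
      rewrite (eq_bigr (fun i => (J i).1)) //.
      by move=> i; case: eqP.
    rewrite (eq_bigr (fun i => (J i).2)) //.
    by move=> i; case: eqP.
- by move=> i; case: eqP => [->|_].
- (* The longest interval has at least the average length, and it loses at
     least half of its length. *)
  have avg : \sum_i width (J i) <= #|I|%:R * width (J m).
    apply: le_trans (ler_sum _ (fun i _ => wm i)) _.
    by rewrite sumr_const mulr_natl.
  have N0 : 0 < #|I|%:R :> R by rewrite ltr0n; apply/card_gt0P; exists i0.
  rewrite (bigD1 m) //= eqxx (eq_bigr (fun i => width (J i))); last first.
    by move=> i; case: eqP.
  rewrite wK; move: avg; rewrite (bigD1 m) //=.
  move: (\sum_(i | i != m) _) => S avg.
  rewrite mulrBl mul1r.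
  suff : (2 * #|I|%:R)^-1 * (width (J m) + S) <= width (J m) / 2 by nra.
  rewrite mulrC ler_pdivrMr; last by lra.
  by nra.
Qed.

(** A point covered by a good family of cylinders is a product of points of the
    Cantor sets: iterating the subdivision gives, in each factor, nested
    cylinders whose lengths tend to 0. *)
Lemma good_mem_product (R : realType) (I : finType) (gamma : I -> R)
    (theta x : R) (J : I -> R * R) :
  (forall i, 0 < gamma i < 1) -> 0 < theta <= 1 ->
  1 <= theta * \sum_i cantor_ratio (gamma i) ->
  good gamma theta x J ->
  exists2 c : I -> R, (forall i, central_cantor (gamma i) (c i)) &
    x = \prod_i c i.
Proof.
move=> g01 th01 hsum Jgood.
pose q : R := 1 - (2 * #|I|%:R)^-1.
have /choice[f fP] : forall K : I -> R * R, exists K', good gamma theta x K ->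
    [/\ good gamma theta x K',
      forall i, (K i).1 <= (K' i).1 /\ (K' i).2 <= (K i).2 &
      \sum_i width (K' i) <= q * \sum_i width (K i)].
  move=> K; have [Kgood|Kbad] := pselect (good gamma theta x K); last first.
    by exists K => /Kbad.
  by have [K' hK'] := good_step g01 th01 hsum Kgood; exists K'.
pose K t := iter t f J.
have Kgood t : good gamma theta x (K t).
  by elim: t => [//|t /fP[]].
have Kcyl t i : cylinder (gamma i) (K t i) by case: (Kgood t) => /(_ i)[].
have w0 t i : 0 <= width (K t i) by case: (Kgood t) => /(_ i)[_ /ltW].
have I0 : (0 < #|I|)%N.
  rewrite lt0n; apply/eqP => I0.
  by move: hsum; rewrite big_pred0 ?mulr0 ?ler10 // => i; have := fintype0 i I0.
have q01 : 0 <= q < 1.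
  have : 1 <= #|I|%:R :> R by rewrite ler1n.
  move=> I1; rewrite /q subr_ge0 ltrBlDr ltrDl invr_gt0 invf_le1; lra.
have wgeo t : \sum_i width (K t i) <= (\sum_i width (J i)) * q ^+ t.
  elim: t => [|t IHt]; first by rewrite expr0 mulr1.
  have [_ _ /le_trans] := fP _ (Kgood t); apply.
  rewrite exprS mulrCA; apply: ler_wpM2l => //; lra.
have wcvg i : (fun t => width (K t i)) @ \oo --> (0 : R).
  apply: (@squeeze_cvgr _ _ _ _ (fun=> 0)
    (fun t => (\sum_i width (J i)) * q ^+ t)).
  - near=> t; rewrite w0 /=; apply: le_trans (wgeo t).
    by rewrite (bigD1 i) //= lerDl; apply: sumr_ge0 => j _; exact: w0.
  - exact: cvg_cst.
  - by apply: cvg_geometric; rewrite ger0_norm; lra.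
have lcvg i : cvgn (fun t => (K t i).1).
  apply: nondecreasing_is_cvgn.
    apply/nondecreasing_seqP => t.
    by have [_ /(_ i)[]] := fP _ (Kgood t).
  exists 1 => _ [t _ <-]; have [_ /(_ i)[_ h] _ _] := Kgood t.
  by have := w0 t i; rewrite /width; lra.
pose c i := limn (fun t => (K t i).1).
have rcvg i : (fun t => (K t i).2) @ \oo --> c i.
  rewrite (_ : (fun t => _) = (fun t => (K t i).1 + width (K t i))); last first.
    by apply/funext => t; rewrite /width addrC subrK.
  by rewrite -[c i]addr0; apply: cvgD; [exact: lcvg|exact: wcvg].
exists c => [i|].
  apply: (closed_cvg _ (@closed_central_cantor _ (gamma i)) _ _ (lcvg i)).
  by near=> t; apply: cylinder_left_end.
have mul_cont := @mul_continuous R.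
apply/eqP; rewrite eq_le; apply/andP; split.
  have h : \prod_i (K t i).2 @[t --> \oo] --> \prod_i c i.
    by apply: cvg_big => // i _; exact: rcvg.
  rewrite -(cvg_lim _ h) //; apply: limr_ge.
    by apply/cvg_ex; eexists; exact: h.
  by near=> t; have [_ _ _ /andP[]] := Kgood t.
have h : \prod_i (K t i).1 @[t --> \oo] --> \prod_i c i.
  by apply: cvg_big => // i _; exact: lcvg.
rewrite -(cvg_lim _ h) //; apply: limr_le.
  by apply/cvg_ex; eexists; exact: h.
by near=> t; have [_ _ _ /andP[]] := Kgood t.
Unshelve. all: by end_near. Qed.

(** * The integer exponents *)

(** With [a = expR s], the graph of [t |-> a ^ (2 t - 1)] is tangent to the line
    of slope [m] through [(c, 0)] when [2 s exp ((2 c - 1) s + 1) = m], and the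
    contact point is then [c + 1 / (2 s)]. The intermediate value theorem gives
    such an [s] between 0 and [m]. *)
Lemma tangent_base_nonempty (R : realType) (m c : R) :
  0 < m -> 1 / 2 <= c -> exists a, tangent_base m c a.
Proof.
move=> m0 c1.
pose h (s : R) := 2 * s * expR ((2 * c - 1) * s + 1).
have h0 : h 0 = 0 by rewrite /h mulr0 mul0r.
have hm : m <= h m.
  have : 1 <= expR ((2 * c - 1) * m + 1) by apply: le_trans (expR_ge1Dx _); nra.
  by rewrite /h; nra.
have [s] : exists2 s, s \in `[0, m] & h s = m.
  apply: IVT; first exact: ltW.
    apply: continuous_subspaceT => s.
    apply: cvgM; first by apply: cvgM; [exact: cvg_cst|exact: cvg_id].
    apply: continuous_comp; last exact: continuous_expR.
    apply: cvgD; last exact: cvg_cst.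
    by apply: cvgM; [exact: cvg_cst|exact: cvg_id].
  rewrite h0 min_l ?max_r ?(ltW m0) //=; lra.
rewrite in_itv /= => /andP[s0 _] hs.
have {}s0 : 0 < s.
  rewrite lt_neqAle s0 andbT; apply/eqP => s00.
  by move: hs; rewrite -s00 h0; lra.
exists (expR s); split; first by rewrite expR_gt1.
have powE t : expR s `^ (2 * t - 1) = expR ((2 * t - 1) * s).
  by rewrite [_ * s]mulrC expRM.
exists (c + 1 / (2 * s)).
have exponent : (2 * (c + 1 / (2 * s)) - 1) * s = (2 * c - 1) * s + 1.
  by field; lra.
split.
  rewrite powE exponent; rewrite -hs /h; field; lra.
under eq_fun do rewrite powE.
have := @is_derive1_comp R expR (fun t => (2 * t - 1) * s) (c + 1 / (2 * s)).
rewrite exponent => /(_ _ (2 * s) (is_derive_expR _)).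
rewrite (_ : _ * (2 * s) = m); last by rewrite -hs /h mulrC.
apply.
apply: is_derive_eq; rewrite /GRing.scale /=; ring.
Qed.

Lemma a_gamma_gt1 (R : realType) (gamma : R) :
  0 < gamma < 1 -> 1 < a_gamma gamma.
Proof.
move=> g01; rewrite /a_gamma; have [g3|g3] := leP gamma (1 / 3).
  have [] // := getPex (@tangent_base_nonempty R 1 1 ltr01 _).
  lra.
have sq : gamma ^+ 2 <= gamma by rewrite expr2 ger_pMr; lra.
have b0 : 0 < b_gamma gamma by apply: divr_gt0; lra.
have [] // := getPex (@tangent_base_nonempty R _ 3 b0 _).
lra.
Qed.

Lemma k_gamma_gt0 (R : realType) (gamma : R) :
  0 < gamma < 1 -> 0 < k_gamma gamma.
Proof.
move=> g01; have a1 := a_gamma_gt1 g01.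
have r01 := cantor_ratio_bounds g01.
rewrite /k_gamma ceil_gt0 -/(cantor_ratio gamma) nmulr_rgt0 ?invr_lt0.
  by rewrite ln_lt0 //; lra.
rewrite ln_lt0 //.
rewrite subr_gt0 ltrBlDr ltrDl ltr_pdivrMr ?divr_gt0; lra.
Qed.

Lemma thetaE (R : realType) (gamma : R) : 0 < gamma < 1 ->
  exists2 k : nat, (0 < k)%N & theta gamma = 1 - cantor_ratio gamma ^+ k.
Proof.
move=> /k_gamma_gt0; rewrite /theta; case: (k_gamma gamma) => // k k0.
by exists k.
Qed.

Lemma theta_bounds (R : realType) (gamma : R) : 0 < gamma < 1 ->
  0 < theta gamma < 1.
Proof.
move=> g01; have [[//|k] _ ->] := thetaE g01.
have r01 := cantor_ratio_bounds g01.
have : 0 < cantor_ratio gamma ^+ k.+1 < 1; last by lra.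
by apply/andP; split; [apply: exprn_gt0|apply: exprn_ilt1 => //]; lra.
Qed.

Lemma theta_mem (R : realType) (gamma : R) : 0 < gamma < 1 ->
  central_cantor gamma (theta gamma).
Proof.
move=> g01; have [k _ ->] := thetaE g01.
by apply: (cylinder_left_end g01 (cylinder_top gamma k)).
Qed.

(** * Products of central Cantor sets *)

Lemma comparable_power (R : realType) (r s : R) : 0 < r < 1 -> 0 < s <= 1 ->
  exists m, r * s <= r ^+ m <= s.
Proof.
move=> r01 s01.
have ex : exists m, r ^+ m <= s.
  have rcvg : r ^+ m @[m --> \oo] --> 0.
    by apply: cvg_expr; rewrite gtr0_norm; lra.
  by apply: (@filter_ex _ \oo); apply: (cvgr_le _ rcvg); lra.
case: (ex_minnP ex) => -[|m] mle mmin.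
  by exists 0%N; rewrite mle andbT expr0; nra.
exists m.+1; rewrite mle andbT exprS; apply: ler_wpM2l; first lra.
apply: ltW; rewrite ltNge; apply/negP => /mmin.
by rewrite ltnn.
Qed.

(** If two members of the family have parameter [g], the rightmost cylinders of
    lengths comparable to [1 - theta g] form a good family, and these two
    members bring the least product down to the square of [theta g]. *)
Lemma product_covers_top (R : realType) (I : finType) (gamma : I -> R)
    (i1 i2 : I) (y : R) :
  i1 != i2 -> gamma i1 = gamma i2 -> (forall i, 0 < gamma i < 1) ->
  1 <= theta (gamma i1) * \sum_i cantor_ratio (gamma i) ->
  theta (gamma i1) ^+ 2 <= y <= 1 ->
  exists2 c : I -> R, (forall i, central_cantor (gamma i) (c i)) &
    y = \prod_i c i.
Proof.
move=> i12 g12 g01 hsum /andP[yl yr].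
have th01 := theta_bounds (g01 i1).
have [k k0 thE] := thetaE (g01 i1).
pose s := 1 - theta (gamma i1).
have s01 : 0 < s < 1 by rewrite /s; lra.
have r01 i := cantor_ratio_bounds (g01 i).
have /choice[m mP] : forall i, exists m,
    cantor_ratio (gamma i) * s <= cantor_ratio (gamma i) ^+ m <= s /\
    (gamma i = gamma i1 -> cantor_ratio (gamma i) ^+ m = s).
  move=> i; have ri := r01 i.
  have [gi|/eqP gi] := eqVneq (gamma i) (gamma i1).
    have sE : cantor_ratio (gamma i) ^+ k = s by rewrite /s thE gi; ring.
    by exists k; rewrite sE lexx andbT; split=> //; nra.
  have [||m hm] := @comparable_power _ (cantor_ratio (gamma i)) s; try lra.
  by exists m.
pose J i := (1 - cantor_ratio (gamma i) ^+ m i, 1 : R).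
have wJ i : width (J i) = cantor_ratio (gamma i) ^+ m i.
  by rewrite /width /=; ring.
have mb i : cantor_ratio (gamma i) * s <= cantor_ratio (gamma i) ^+ m i <= s.
  by have [] := mP i.
apply: (@good_mem_product _ _ _ (theta (gamma i1)) _ J) => //; first lra.
split.
- move=> i; split; first exact: cylinder_top.
  by rewrite wJ exprn_gt0 //; have := r01 i; lra.
- by move=> i; split=> //=; have := mb i; rewrite /s; lra.
- move=> i j; rewrite !wJ.
  apply: (@le_trans _ _ (cantor_ratio (gamma j) * s)).
    by apply: ler_wpM2l; [have := r01 j|have := mb i]; lra.
  by have := mb j; lra.
- rewrite [X in _ && (_ <= X)]big1 // yr andbT; apply: le_trans yl.
  rewrite (bigD1 i1) // (bigD1 i2) /= 1?eq_sym //.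
  have [_ ->//] := mP i1; have [_ ->//] := mP i2.
  rewrite (_ : 1 - s = theta (gamma i1)); last by rewrite /s; ring.
  rewrite mulrA -expr2 ger_pMr; last by rewrite exprn_gt0; lra.
  apply: prodr_ile1 => i _.
  by have := mb i; have := r01 i; rewrite /s /=; nra.
Qed.

Lemma prod_theta_bounds (R : realType) (a b : nat) (gamma : nat -> R) :
  (forall i, (a <= i < b)%N -> 0 < gamma i < 1) ->
  0 < \prod_(a <= i < b) theta (gamma i) <= 1.
Proof.
move=> g01; rewrite big_nat_cond.
apply: (big_ind (fun x : R => 0 < x <= 1)); first by lra.
  by move=> x y hx hy; nra.
by move=> i; rewrite andbT => /g01/theta_bounds; lra.
Qed.

Lemma chi_le_theta (R : realType) (n p : nat) (alpha beta : nat -> R) :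
  (1 <= n)%N -> (forall i, (1 <= i <= n)%N -> 0 < alpha i < 1) ->
  (forall i, (1 <= i <= p)%N -> 0 < beta i < 1) ->
  chi n p alpha beta <= theta (alpha 1%N).
Proof.
move=> n1 a01 b01; rewrite /chi big_ltn //.
have := @prod_theta_bounds R 1 p.+1 beta b01.
have : 0 < \prod_(2 <= i < n.+1) theta (alpha i) <= 1.
  by apply: prod_theta_bounds => i /andP[i2 ilt]; apply: a01; rewrite ltnW.
have [] := andP (@theta_bounds R (alpha 1%N) (a01 1%N n1)).
move: (theta _) (\prod_(2 <= i < _) _) (\prod_(1 <= i < _) _) => t x y t0 t1.
move=> x01 y01; rewrite -mulrA -[X in _ <= X]mulr1; apply: ler_wpM2l; nra.
Qed.

Lemma chiC (R : realType) (n p : nat) (alpha beta : nat -> R) :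
  chi n p alpha beta = chi p n beta alpha.
Proof. exact: mulrC. Qed.

Lemma GammaC (R : realType) (n p : nat) (alpha beta : nat -> R) :
  Gamma n p alpha beta `<=` Gamma p n beta alpha.
Proof. by move=> x [c [d [hc hd ->]]]; exists d, c; rewrite mulrC. Qed.

(** The factors with parameters [beta 2], ..., [beta p] are kept equal to
    [theta (beta i)], and the remaining ones sweep out the interval. *)
Lemma Gamma_contains_interval (R : realType) (n p : nat)
    (alpha beta : nat -> R) :
  (1 <= n)%N -> (1 <= p)%N ->
  (forall i, (1 <= i <= n)%N -> 0 < alpha i < 1) ->
  (forall i, (1 <= i <= p)%N -> 0 < beta i < 1) ->
  alpha 1%N = beta 1%N ->
  1 <= chi n p alpha beta * \sum_(1 <= i < n.+1) cantor_ratio (alpha i) ->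
  `[(\prod_(1 <= i < p.+1) theta (beta i)) * theta (alpha 1%N),
    \prod_(2 <= i < p.+1) theta (beta i)] `<=` Gamma n p alpha beta.
Proof.
move=> n1 p1 a01 b01 ab hsum x; rewrite /= in_itv /= big_ltn //.
set T := \prod_(2 <= i < p.+1) _ => /andP[xl xr].
have [T0 _] : 0 < T /\ T <= 1.
  apply/andP; apply: prod_theta_bounds => i /andP[i2 ilt].
  by apply: b01; rewrite ltnW.
(* The index 0 stands for the factor with parameter [beta 1]. *)
pose gamma (i : 'I_n.+1) := if i == 0%N :> nat then beta 1%N else alpha i.
pose i1 : 'I_n.+1 := inord 1.
have i1E : i1 = 1%N :> nat by rewrite inordK.
have g0 : gamma ord0 = alpha 1%N by [].
have g1 : gamma i1 = alpha 1%N by rewrite /gamma i1E.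
have g01 i : 0 < gamma i < 1.
  rewrite /gamma; case: eqP => [_|/eqP i0]; first exact: b01.
  by apply: a01; rewrite lt0n i0 -ltnS ltn_ord.
have thg : theta (gamma ord0) = theta (alpha 1%N) by rewrite g0.
have [|||||c cC xE] := @product_covers_top _ _ gamma ord0 i1 (x / T).
- by rewrite -val_eqE /= i1E.
- by rewrite g1.
- exact: g01.
- apply: le_trans hsum _; rewrite thg.
  have th0 := theta_bounds (a01 1%N n1).
  have S0 : 0 <= \sum_(1 <= i < n.+1) cantor_ratio (alpha i).
    rewrite big_nat; apply: sumr_ge0 => i /a01/cantor_ratio_bounds; lra.
  apply: le_trans (ler_wpM2r S0 (chi_le_theta n1 a01 b01)) _.
  apply: ler_wpM2l; first lra.
  rewrite big_ord_recl big_add1 /= big_mkord.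
  by rewrite lerDr; have := cantor_ratio_bounds (g01 ord0); lra.
- rewrite thg ler_pdivlMr // ler_pdivrMr // mul1r xr andbT.
  rewrite (_ : _ * T = theta (beta 1%N) * T * theta (alpha 1%N)) //.
  by rewrite -ab; ring.
exists (fun i => c (inord i)).
exists (fun i => if i == 1%N then c ord0 else theta (beta i)).
split.
- move=> i i1n.
  have iE : (inord i : 'I_n.+1) = i :> nat.
    by rewrite inordK // ltnS; case/andP: i1n.
  have := cC (inord i); rewrite /gamma iE.
  by case: eqP i1n => // ->.
- move=> l lp; case: eqP => [->|_]; first exact: (cC ord0).
  by apply: theta_mem; apply: b01.
- rewrite -[LHS](divfK (lt0r_neq0 T0)) xE big_ord_recl.
  rewrite [in RHS]big_add1 /= big_mkord [in RHS]big_ltn //= mulrCA mulrA.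
  congr (_ * _ * _).
    by apply: eq_bigr => i _; congr c; apply: val_inj; rewrite /= inordK ?ltnS.
  by rewrite /T; apply: eq_big_nat => i /andP[i2 _]; case: eqP i2 => // ->.
Qed.

(* Finite families are functions on nat used at the indices 1, ..., n (or p)
   only. *)
Theorem theorem6 (R : realType) (n p n1 n2 r1 r2 : nat)
    (alpha beta : nat -> R)
    (hn : (1 <= n)%N) (hp : (1 <= p)%N)
    (hn12 : (n1 + n2 = n)%N) (hr12 : (r1 + r2 = p)%N)
    (alpha01 : forall i, (1 <= i <= n)%N -> 0 < alpha i < 1)
    (beta01 : forall i, (1 <= i <= p)%N -> 0 < beta i < 1)
    (alpha_mono : forall i j, (1 <= i)%N -> (i <= j)%N -> (j <= n)%N ->
      alpha j <= alpha i)
    (beta_mono : forall i j, (1 <= i)%N -> (i <= j)%N -> (j <= p)%N ->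
      beta j <= beta i)
    (alpha_beta : alpha 1%N = beta 1%N)
    (halpha1 : (3 * alpha 1%N - 1) / (1 + alpha 1%N) <
      chi n p alpha beta * \sum_(1 <= i < n1.+1) ((1 - alpha i) / 2) ^+ 2)
    (halpha2 : 1 <
      chi n p alpha beta * \sum_(1 + n1 <= i < (n1 + n2).+1) ((1 - alpha i) / 2))
    (hbeta1 : (3 * beta 1%N - 1) / (1 + beta 1%N) <
      chi n p alpha beta * \sum_(1 <= i < r1.+1) ((1 - beta i) / 2) ^+ 2)
    (hbeta2 : 1 <
      chi n p alpha beta * \sum_(1 + r1 <= i < (r1 + r2).+1) ((1 - beta i) / 2)) :
  `[(\prod_(1 <= i < p.+1) theta (beta i)) * theta (alpha 1%N),
    \prod_(2 <= i < p.+1) theta (beta i)] `<=` Gamma n p alpha beta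
  /\
  `[(\prod_(1 <= i < n.+1) theta (alpha i)) * theta (beta 1%N),
    \prod_(2 <= i < n.+1) theta (alpha i)] `<=` Gamma n p alpha beta.
Proof.
have partial m N (gamma : nat -> R) : (m <= N)%N ->
    (forall i, (1 <= i <= N)%N -> 0 < gamma i < 1) ->
    \sum_(1 + m <= i < N.+1) ((1 - gamma i) / 2) <=
    \sum_(1 <= i < N.+1) cantor_ratio (gamma i).
  move=> mN g01; rewrite [leRHS](@big_cat_nat _ _ _ m.+1) //= lerDr.
  rewrite big_nat; apply: sumr_ge0 => i /andP[i1 im].
  have /g01/cantor_ratio_bounds : (1 <= i <= N)%N.
    by rewrite i1 (leq_trans _ mN).
  lra.
have chi0 : 0 <= chi n p alpha beta.
  have := @prod_theta_bounds R 1 n.+1 alpha alpha01.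
  have := @prod_theta_bounds R 1 p.+1 beta beta01.
  by move=> h1 h2; apply: mulr_ge0; lra.
rewrite hn12 in halpha2; rewrite hr12 in hbeta2.
split.
  apply: Gamma_contains_interval => //; apply: le_trans (ltW halpha2) _.
  by apply: ler_wpM2l => //; apply: partial => //; rewrite -hn12 leq_addr.
apply: subset_trans (@GammaC R p n beta alpha).
apply: Gamma_contains_interval => //; apply: le_trans (ltW hbeta2) _.
rewrite (chiC p n); apply: ler_wpM2l => //.
by apply: partial => //; rewrite -hr12 leq_addr.
Qed.
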